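(* Let $\mathbb{Z}_{(2)}=\{\frac{m}{n} : m,n\in\mathbb{Z},\ 2\nmid n\}$. Then $M_3(\mathbb{Z}_{(2)})$ is not strongly clean and is not quasipolar. However, the following subrings of $M_3(\mathbb{Z}_{(2)})$ are all quasipolar: $$\begin{bmatrix}\mathbb{Z}_{(2)}&0&0\\0&\mathbb{Z}_{(2)}&0\\ \mathbb{Z}_{(2)}&0&\mathbb{Z}_{(2)}\end{bmatrix},\quad \begin{bmatrix}\mathbb{Z}_{(2)}&0&0\\ \mathbb{Z}_{(2)}&\mathbb{Z}_{(2)}&\mathbb{Z}_{(2)}\\0&0&\mathbb{Z}_{(2)}\end{bmatrix},\quad \begin{bmatrix}\mathbb{Z}_{(2)}&0&\mathbb{Z}_{(2)}\\0&\mathbb{Z}_{(2)}&0\\0&0&\mathbb{Z}_{(2)}\end{bmatrix},\quad \begin{bmatrix}\mathbb{Z}_{(2)}&0&0\\0&\mathbb{Z}_{(2)}&0\\ \mathbb{Z}_{(2)}&\mathbb{Z}_{(2)}&\mathbb{Z}_{(2)}\end{bmatrix}.$$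
   Context: Each displayed array denotes the ring of all $3\times 3$ matrices whose entries are arbitrary elements of $\mathbb{Z}_{(2)}$ in the positions marked $\mathbb{Z}_{(2)}$ and are $0$ in the positions marked $0$, with the usual matrix operations. For $a$ in an associative ring $R$ with identity and unit group $U(R)$: $comm(a)=\{x\in R: xa=ax\}$, $comm^2(a)=\{x\in R: xy=yx \text{ for all } y\in comm(a)\}$, and $R^{qnil}=\{a\in R: 1+ax\in U(R)\text{ for every }x\in comm(a)\}$. An element $a\in R$ is quasipolar if there is an idempotent $p=p^2\in R$ with $p\in comm^2(a)$, $a+p\in U(R)$ and $ap\in R^{qnil}$. A ring is quasipolar if each of its elements is quasipolar. A ring $R$ is strongly clean if every $a\in R$ can be written as $a=e+u$ with $e^2=e$, $u\in U(R)$ and $eu=ue$. *)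

(* Defs.v *)
From HB Require Import structures.
From mathcomp Require Import all_boot all_order all_algebra.
From mathcomp Require Import boolp.

Set Implicit Arguments.
Unset Strict Implicit.
Unset Printing Implicit Defensive.

Import GRing.Theory Num.Theory.
Local Open Scope ring_scope.

Section Quasipolar.
Variable R : pzRingType.
Implicit Types a x y : R.

(* Units are defined here by two-sided inverses, since the rings considered
   carry no canonical unitRingType structure. *)
Definition is_unit a : Prop := exists b : R, a * b = 1 /\ b * a = 1.

Definition comm1 a x : Prop := x * a = a * x.

Definition comm2 a x : Prop := forall y, comm1 a y -> x * y = y * x.

Definition qnil a : Prop := forall x, comm1 a x -> is_unit (1 + a * x).

Definition quasipolar_elt a : Prop :=
  exists p : R, [/\ p * p = p, comm2 a p, is_unit (a + p) & qnil (a * p)].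

Definition strongly_clean_elt a : Prop :=
  exists e u : R, [/\ a = e + u, e * e = e, is_unit u & e * u = u * e].

End Quasipolar.

Definition quasipolar (R : pzRingType) : Prop :=
  forall a : R, quasipolar_elt a.

Definition strongly_clean (R : pzRingType) : Prop :=
  forall a : R, strongly_clean_elt a.

Definition Zloc2_pred : {pred rat} :=
  fun q => `[< exists m n : int, ~~ (2 %| n)%Z /\ q = m%:~R / n%:~R >].

Fact Zloc2_subring : subring_closed Zloc2_pred.
Proof.
have nz (n : int) : ~~ (2 %| n)%Z -> n%:~R != 0 :> rat.
  by rewrite intr_eq0; apply: contraNneq => ->.
have odd_mul (n n' : int) :
    ~~ (2 %| n)%Z -> ~~ (2 %| n')%Z -> ~~ (2 %| n * n')%Z.
  by move=> hn hn'; rewrite !dvdzE abszM Euclid_dvdM // negb_or; apply/andP.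
split.
- by apply/asboolP; exists 1, 1.
- move=> x y /asboolP[m [n [hn ->]]] /asboolP[m' [n' [hn' ->]]].
  apply/asboolP; exists (m * n' - m' * n), (n * n'); split; first exact: odd_mul.
  by rewrite -mulNr addf_div ?nz // mulNr -!intrM -intrB.
- move=> x y /asboolP[m [n [hn ->]]] /asboolP[m' [n' [hn' ->]]].
  apply/asboolP; exists (m * m'), (n * n'); split; first exact: odd_mul.
  by rewrite mulf_div -!intrM.
Qed.

HB.instance Definition _ := GRing.isSubringClosed.Build rat Zloc2_pred
  Zloc2_subring.

Definition Zloc2 : Type := {q : rat | q \in Zloc2_pred}.
HB.instance Definition _ := SubChoice.on Zloc2.
HB.instance Definition _ := [SubChoice_isSubComNzRing of Zloc2 by <:].

(* [pattern rows i j] tells whether row i of the displayed array allows a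
   nonzero entry in column j (0-based). *)
Definition pattern (rows : seq (seq bool)) : rel 'I_3 :=
  fun i j => nth false (nth [::] rows i) j.

(* Reflexivity puts 1 in the set of matrices supported on the pattern, and
   transitivity makes that set closed under multiplication. *)
Record ringPattern := RingPattern {
  pattern_rel :> rel 'I_3;
  pattern_refl : reflexive pattern_rel;
  pattern_trans : transitive pattern_rel
}.

Section PatternRing.
Variable P : ringPattern.

Definition has_pattern : {pred 'M[Zloc2]_3} :=
  fun A => [forall i, forall j, ~~ P i j ==> (A i j == 0)].

Fact has_patternP (A : 'M[Zloc2]_3) :
  reflect (forall i j, ~~ P i j -> A i j = 0) (A \in has_pattern).
Proof.
apply: (iffP forallP) => [h i j nP|h i].
  by have /forallP/(_ j)/implyP/(_ nP)/eqP := h i.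
by apply/forallP => j; apply/implyP => nP; apply/eqP/h.
Qed.

Fact has_pattern_subring : subring_closed has_pattern.
Proof.
split.
- apply/has_patternP => i j nP; rewrite mxE.
  by case: eqP nP => // ->; rewrite pattern_refl.
- move=> A B /has_patternP hA /has_patternP hB.
  by apply/has_patternP => i j nP; rewrite !mxE hA ?hB ?subr0.
- move=> A B /has_patternP hA /has_patternP hB.
  apply/has_patternP => i j nP; rewrite mxE big1 // => k _.
  case Pik: (P i k); last by rewrite hA ?Pik ?mul0r.
  rewrite hB ?mulr0 //; apply: contra nP; exact: pattern_trans.
Qed.

HB.instance Definition _ := GRing.isSubringClosed.Build 'M[Zloc2]_3 has_pattern
  has_pattern_subring.

Definition patternRing : Type := {A : 'M[Zloc2]_3 | A \in has_pattern}.
HB.instance Definition _ := SubChoice.on patternRing.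
HB.instance Definition _ := [SubChoice_isSubNzRing of patternRing by <:].

End PatternRing.

Definition support1 := pattern
  [:: [:: true;  false; false];
      [:: false; true;  false];
      [:: true;  false; true ]].

Fact support1_refl : reflexive support1.
Proof. by case=> [[|[|[|?]]] ?]. Qed.

Fact support1_trans : transitive support1.
Proof. by do 3![case=> [[|[|[|?]]] ?]]. Qed.

Definition array1 := RingPattern support1_refl support1_trans.

Definition support2 := pattern
  [:: [:: true;  false; false];
      [:: true;  true;  true ];
      [:: false; false; true ]].

Fact support2_refl : reflexive support2.
Proof. by case=> [[|[|[|?]]] ?]. Qed.

Fact support2_trans : transitive support2.
Proof. by do 3![case=> [[|[|[|?]]] ?]]. Qed.

Definition array2 := RingPattern support2_refl support2_trans.

Definition support3 := pattern
  [:: [:: true;  false; true ];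
      [:: false; true;  false];
      [:: false; false; true ]].

Fact support3_refl : reflexive support3.
Proof. by case=> [[|[|[|?]]] ?]. Qed.

Fact support3_trans : transitive support3.
Proof. by do 3![case=> [[|[|[|?]]] ?]]. Qed.

Definition array3 := RingPattern support3_refl support3_trans.

Definition support4 := pattern
  [:: [:: true;  false; false];
      [:: false; true;  false];
      [:: true;  true;  true ]].

Fact support4_refl : reflexive support4.
Proof. by case=> [[|[|[|?]]] ?]. Qed.

Fact support4_trans : transitive support4.
Proof. by do 3![case=> [[|[|[|?]]] ?]]. Qed.

Definition array4 := RingPattern support4_refl support4_trans.

(* Main.v *)
Require Import Defs.
From mathcomp Require Import all_boot all_order all_algebra.
From mathcomp Require Import fingroup perm boolp ring.

Set Implicit Arguments.
Unset Strict Implicit.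
Unset Printing Implicit Defensive.

Import GRing.Theory Num.Theory.
Local Open Scope ring_scope.

(* Each of the four patterns is a partial order, so the matrices it supports are
   triangular up to a permutation of the basis: units, and the values of
   polynomials, are read off the diagonal. Splitting the characteristic
   polynomial of [A] as [f * g], with [f] collecting the diagonal entries that
   are units and [g] the others, locality of the base ring makes [f] and [g]
   comaximal, and a Bezout relation yields the spectral idempotent of [A] as a
   polynomial in [A].

   For the full matrix ring, a strongly clean decomposition [e + u] of the
   companion matrix [C] of a cubic irreducible over the rationals has [e]
   commuting with [C], hence [e = 0] or [e = 1], so that [C] or [C - 1] is
   invertible; neither is when the cubic takes even values at 0 and at 1. *)

(** * Units of the localization *)

Lemma odd_ratr_neq0 (k : int) : ~~ (2 %| k)%Z -> k%:~R != 0 :> rat.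
Proof. by rewrite intr_eq0; apply: contraNneq => ->. Qed.

Lemma Zloc2_unitP (x : Zloc2) (m n : int) :
  ~~ (2 %| m)%Z -> ~~ (2 %| n)%Z -> val x = m%:~R / n%:~R -> is_unit x.
Proof.
move=> hm hn xE.
have yP : (n%:~R / m%:~R : rat) \in Zloc2_pred by apply/asboolP; exists n, m.
pose y : Zloc2 := exist [in Zloc2_pred] _ yP.
have xy1 : x * y = 1.
  by apply: val_inj; rewrite /= xE mulf_div (mulrC n%:~R) divff //
    mulf_neq0 ?odd_ratr_neq0.
by exists y; split; rewrite // mulrC.
Qed.

(** The parity of the numerator decides: for [m] even and [n], [n'] odd, [n * n' + m * m'] is
    odd. *)
Lemma Zloc2_local (x : Zloc2) : is_unit x \/ forall y, is_unit (1 + x * y).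
Proof.
have /asboolP[m [n [hn xE]]] := valP x.
case: (boolP (2 %| m)%Z) => [hm|hm]; last by left; apply: Zloc2_unitP xE.
right=> y; have /asboolP[m' [n' [hn' yE]]] := valP y.
have hnn' : ~~ (2 %| n * n')%Z.
  by move: hn hn'; rewrite !dvdzE abszM Euclid_dvdM // negb_or => -> ->.
apply: (@Zloc2_unitP _ (n * n' + m * m') (n * n')) => //.
  rewrite rpredDr; last exact: dvdz_mulr.
  exact: hnn'.
rewrite -[LHS]/(1 + val x * val y) xE yE mulf_div -!rmorphM rmorphD mulrDl
  divff //.
exact: odd_ratr_neq0.
Qed.

Lemma Zloc2_two_nunit (x : Zloc2) : 2 * x != 1.
Proof.
apply/eqP => x1; have : 2 * val x = 1 := congr1 val x1.
have /asboolP[m [n [hn ->]]] := valP x.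
rewrite mulrA => /(canRL (divfK (odd_ratr_neq0 hn)))/eqP.
rewrite mul1r -[2]/(2%:~R) -rmorphM /= eqr_int => /eqP nE.
by rewrite -nE dvdz_mulr in hn.
Qed.

(** By locality, [a - b = a * (1 - b * a')] is a product of units. *)
Lemma Zloc2_unit_sub (a b : Zloc2) :
  is_unit a -> ~ is_unit b -> is_unit (a - b).
Proof.
case=> a' [aa' _]; case: (Zloc2_local b) => // /(_ (- a'))[c [hc _]] _.
have h : (a - b) * (a' * c) = 1.
  by rewrite -hc; ring: aa'.
by exists (a' * c); split; rewrite // mulrC.
Qed.

(** * Comaximal polynomials *)

Section Comaximal.
Variable R : comNzRingType.

Definition comaximal (f g : {poly R}) : Prop := exists u v, u * f + v * g = 1.

Lemma comaximal_sym f g : comaximal f g -> comaximal g f.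
Proof. by case=> u [v h]; exists v, u; rewrite addrC. Qed.

Lemma comaximal_prodr (I : finType) (Q : pred I) f (g : I -> {poly R}) :
  (forall i, Q i -> comaximal f (g i)) -> comaximal f (\prod_(i | Q i) g i).
Proof.
move=> h; elim/big_ind: _ => //.
  by exists 0, 1; rewrite mul0r mul1r add0r.
move=> g1 g2 [u [v h1]] [u' [v' h2]].
(* Multiply the two relations: every term but [v * v' * (g1 * g2)] is a multiple of [f]. *)
exists (u * u' * f + u * v' * g2 + v * g1 * u'), (v * v').
by rewrite -[RHS](mulr1 1) -{1}h1 -h2; ring.
Qed.

(** The two polynomials differ by the unit constant [a - b]. *)
Lemma comaximal_XsubC a b : is_unit (a - b) ->
  comaximal ('X - a%:P) ('X - b%:P).
Proof.
case=> c [h _]; exists (- c%:P), c%:P.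
by rewrite -[RHS]polyC1 -h rmorphM rmorphB /=; ring.
Qed.

End Comaximal.

(* A permutation [s] contributing to [\det M] satisfies [P i (s i)] for all [i];
   following the cycle of [i] back to [i] gives [P (s i) i], so [s] is 1. *)
Lemma det_antisymmetric (R : comNzRingType) n (P : rel 'I_n) (M : 'M[R]_n) :
  reflexive P -> antisymmetric P -> transitive P ->
  (forall i j, ~~ P i j -> M i j = 0) -> \det M = \prod_i M i i.
Proof.
move=> Prefl Panti Ptrans hM.
rewrite /determinant (bigD1 (1%g : {perm 'I_n})) //=
  [X in _ + X]big1 ?addr0 => [|s s1].
  by rewrite odd_perm1 mul1r; apply: eq_bigr => i _; rewrite perm1.
suff /existsP[i /hM Mi0] : [exists i, ~~ P i (s i)].
  by rewrite (bigD1 i) //= Mi0 mul0r mulr0.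
apply: contraNT s1 => /existsPn hs; apply/eqP/permP => i; rewrite perm1.
have Ps j : P j (s j) by apply/negPn.
have Pit k : P (s i) ((s ^+ k.+1)%g i).
  elim: k => [|k IH]; first by rewrite expg1.
  by apply: Ptrans IH _; rewrite [in X in P _ X]expgSr permM.
apply: Panti; rewrite Ps andbT.
by have := Pit #[s]%g.-1; rewrite prednK // expg_order perm1.
Qed.

(** * Rings of matrices supported on a partial order *)

Section AntisymmetricPattern.
Variable P : ringPattern.
Hypothesis Panti : antisymmetric P.

Lemma has_pattern_horner (A : 'M[Zloc2]_3) (q : {poly Zloc2}) :
  A \in has_pattern P -> horner_mx A q \in has_pattern P.
Proof.
move=> hA; elim/poly_ind: q => [|q c IH]; first by rewrite rmorph0 rpred0.
rewrite rmorphD rmorphM /= horner_mx_X horner_mx_C rpredD ?rpredM //.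
apply/has_patternP => i j; rewrite mxE.
by case: eqP => // ->; rewrite pattern_refl.
Qed.

(** A term [A i k * B k i] survives only if [P i k] and [P k i], hence [k = i]. *)
Lemma diag_mul (A B : 'M[Zloc2]_3) i :
  A \in has_pattern P -> B \in has_pattern P -> (A * B) i i = A i i * B i i.
Proof.
move=> /has_patternP hA /has_patternP hB.
rewrite mxE (bigD1 i) //= big1 ?addr0 // => k /eqP ki.
case: (boolP (P i k)) => [Pik|/hA ->]; last by rewrite mul0r.
rewrite hB ?mulr0 //; apply/negP => Pki; apply: ki; apply: Panti.
by rewrite Pik Pki.
Qed.

Lemma diag_horner (A : 'M[Zloc2]_3) (q : {poly Zloc2}) i :
  A \in has_pattern P -> horner_mx A q i i = q.[A i i].
Proof.
move=> hA; elim/poly_ind: q => [|q c IH]; first by rewrite rmorph0 horner0 mxE.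
rewrite rmorphD rmorphM /= horner_mx_X horner_mx_C mxE diag_mul //.
  by rewrite IH hornerMXaddC mxE eqxx.
exact: has_pattern_horner.
Qed.

Lemma char_poly_pattern (A : 'M[Zloc2]_3) :
  A \in has_pattern P -> char_poly A = \prod_i ('X - (A i i)%:P).
Proof.
move=> /has_patternP hA; rewrite /char_poly (@det_antisymmetric _ _ P) //.
- by apply: eq_bigr => i _; rewrite !mxE eqxx.
- exact: pattern_refl.
- exact: pattern_trans.
move=> i j nP; rewrite !mxE hA // subr0.
by case: eqP nP => // ->; rewrite pattern_refl.
Qed.

(** By Cayley-Hamilton, a Bezout relation between ['X] and the characteristic polynomial gives an
    inverse that is a polynomial in [A], so it keeps the pattern. *)
Lemma patternRing_unit (A : patternRing P) :
  (forall i, is_unit (val A i i)) -> is_unit A.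
Proof.
move=> hA.
have [u [v uv]] : comaximal 'X (char_poly (val A)).
  rewrite (char_poly_pattern (valP A)); apply: comaximal_prodr => i _.
  apply: comaximal_sym; rewrite -['X in X in comaximal _ X]subr0 -polyC0.
  by apply: comaximal_XsubC; rewrite subr0.
have uA : horner_mx (val A) u * val A = 1.
  have := congr1 (horner_mx (val A)) uv.
  by rewrite rmorphD !rmorphM /= Cayley_Hamilton mulr0 addr0 horner_mx_X rmorph1.
have Au : val A * horner_mx (val A) u = 1.
  by rewrite -uA -{1 4}(horner_mx_X (val A)) -!rmorphM mulrC.
exists (exist [in has_pattern P] _ (has_pattern_horner u (valP A))).
by split; apply: val_inj.
Qed.

(* The idempotent is the polynomial in [A] taking the value 0 at the diagonal
   entries that are units and 1 at the others. *)
Theorem quasipolar_patternRing : quasipolar (patternRing P).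
Proof.
move=> A; pose d i := val A i i; pose T i := `[< is_unit (d i) >].
pose f := \prod_(i | T i) ('X - (d i)%:P).
pose g := \prod_(i | ~~ T i) ('X - (d i)%:P).
have fg : f * g = char_poly (val A).
  by rewrite (char_poly_pattern (valP A)) (bigID T).
have [u [v uv]] : comaximal f g.
  apply: comaximal_prodr => j /asboolPn Tj.
  apply/comaximal_sym/comaximal_prodr => i /asboolP Ti.
  by apply/comaximal_sym/comaximal_XsubC/Zloc2_unit_sub.
pose p : patternRing P :=
  exist [in has_pattern P] _ (has_pattern_horner (u * f) (valP A)).
have pE i : val p i i = (u * f).[d i] by rewrite /= (diag_horner _ _ (valP A)).
have pT i : T i -> val p i i = 0.
  move=> Ti; rewrite pE hornerM horner_prod (bigD1 i) //= hornerXsubC subrr.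
  by rewrite mul0r mulr0.
have pN i : ~~ T i -> val p i i = 1.
  move=> Ti; rewrite pE -[u * f](addrK (v * g)) uv hornerD hornerN
    hornerM hornerC.
  by rewrite horner_prod (bigD1 i) //= hornerXsubC subrr mul0r mulr0 subr0.
exists p; split.
(* [u * f * (1 - u * f)] is a multiple of [f * g], which vanishes at [A]. *)
- apply: val_inj => /=; rewrite -rmorphM.
  have -> : (u * f) * (u * f) = u * f - u * v * (f * g).
    by rewrite -{3}[u * f]mulr1 -uv; ring.
  have fg0 : horner_mx (val A) (u * v * (f * g)) = 0.
    by rewrite fg rmorphM /= Cayley_Hamilton mulr0.
  by rewrite rmorphB /= fg0 subr0.
- move=> y /(congr1 val) /= yA; apply: val_inj => /=.
  have cyA : comm_mx (val y) (val A) by [].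
  exact/esym/(comm_mx_horner (u * f) cyA).
- apply: patternRing_unit => i.
  rewrite -[val _]/(val A + val p) mxE -/(d i); case: (boolP (T i)) => Ti.
    by rewrite pT // addr0; apply/asboolP.
  rewrite pN //; case: (Zloc2_local (d i)) => [/asboolP h|/(_ 1)].
    by move/negP: Ti.
  by rewrite mulr1 addrC.
(* The diagonal entries are 1 where [d i] is a unit, and 1 plus a multiple of the non-unit [d i]
   elsewhere. *)
- move=> x _; apply: patternRing_unit => i.
  rewrite -[val _]/(1%:M + val A * val p * val x) 2!mxE eqxx.
  rewrite !diag_mul ?rpredM ?(valP A) ?(valP p) ?(valP x) // -/(d i).
  case: (boolP (T i)) => Ti.
    by rewrite pT // mulr0 mul0r addr0; exists 1; rewrite mulr1.
  rewrite -mulrA; case: (Zloc2_local (d i)) => [/asboolP h|]; last exact.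
  by move/negP: Ti.
Qed.

End AntisymmetricPattern.

(** * Strong cleanness *)

(** Quasipolarity is applied to [- a]: as [- a + p] is a unit, so is [a - p]. *)
Lemma quasipolar_strongly_clean (R : pzRingType) :
  quasipolar R -> strongly_clean R.
Proof.
move=> hR a; have [p [pp cp [b [hb1 hb2]] _]] := hR (- a).
have pa : p * a = a * p by apply: cp; rewrite /comm1 mulrN mulNr.
exists p, (a - p); split => //; first by rewrite addrC subrK.
  have uE : a - p = - (- a + p) by rewrite opprD opprK.
  by exists (- b); rewrite uE !mulrNN.
by rewrite mulrBr mulrBl pa.
Qed.

Section IdempotentCommutant.
Variable F : fieldType.

Lemma rank1_stable_eigenvector n (A V : 'M[F]_n) :
  \rank V = 1%N -> stablemx V A ->
  exists2 v : 'rV[F]_n, v != 0 & exists l, v *m A = l *: v.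
Proof.
move=> rV; rewrite -(eqmx_stable _ (eq_row_base V)).
move: (row_base V) (row_base_free V); rewrite rV => v vfree /sub_rVP[l vA].
exists v; last by exists l.
by move: vfree; rewrite /row_free; apply: contraTneq => ->; rewrite mxrank0.
Qed.

(* One of the image and the kernel of a nontrivial idempotent is a line. *)
Lemma idempotent_commuting_no_eigenvector (A E : 'M[F]_3) :
  (forall (v : 'rV[F]_3) l, v *m A = l *: v -> v = 0) ->
  E *m E = E -> comm_mx E A -> E = 0 \/ E = 1.
Proof.
move=> noeig EE cEA.
have noline (V : 'M[F]_3) : \rank V = 1%N -> stablemx V A -> False.
  by move=> rV /(rank1_stable_eigenvector rV)[v /eqP v0 [l /noeig]].
have rker := mxrank_ker E; have := rank_leq_row E.
case rE: (\rank E) rker => [|[|[|[|r]]]] // rker _.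
- by left; apply/eqP; rewrite -mxrank_eq0 rE.
- by case: (noline E) => //; apply: comm_mx_stable.
- by case: (noline (kermx E)) => //; apply: comm_mx_stable_ker.
right; have uE : E \in unitmx by rewrite -row_free_unit /row_free rE.
by rewrite -[LHS](mulKmx uE) EE mulVmx.
Qed.

End IdempotentCommutant.

(* The companion matrix of ['X^3 + 3 'X + 6]: this polynomial is irreducible
   over the rationals (Eisenstein at 3), and its values at 0 and 1 are even. *)
Definition cubic_companion (R : pzRingType) : 'M[R]_3 :=
  \matrix_(i, j) nth 0 (nth [::] [:: [:: 0; 0; -6];
                                     [:: 1; 0; -3];
                                     [:: 0; 1; 0]] i) j.

(** For [l = m / n] in lowest terms, clearing denominators forces 3 to divide [m], and then [n]. *)
Lemma cubic_no_rat_root (l : rat) : l ^+ 3 + 3 * l + 6 != 0.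
Proof.
apply/eqP => h.
have n0 : (denq l)%:~R != 0 :> rat by rewrite intr_eq0 denq_neq0.
have {h} : numq l ^+ 3 + 3 * numq l * denq l ^+ 2 + 6 * denq l ^+ 3 = 0.
  apply/eqP; rewrite -(@intr_eq0 rat) !(rmorphD, rmorphM, rmorphXn) /=.
  apply/eqP.
  move: h; rewrite -{1 2}(divq_num_den l) => h.
  rewrite -[RHS](mulr0 ((denq l)%:~R ^+ 3)) -h; field.
  exact: n0.
move: (numq l) (denq l) (coprime_num_den l) => m n cop h.
have /dvdzP[k mE] : (3 %| m)%Z.
  have : (3 %| m ^+ 3)%Z.
    have -> : m ^+ 3 = 3 * (- m * n ^+ 2 - 2 * n ^+ 3).
      by rewrite -[LHS]subr0 -h; ring.
    exact: dvdz_mulr.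
  by rewrite !dvdzE abszX Euclid_dvdX // andbT.
have : (3 %| 2 * n ^+ 3)%Z.
  have -> : 2 * n ^+ 3 = 3 * (- 3 * k ^+ 3 - k * n ^+ 2).
    by apply: (mulfI (_ : 3 != 0)) => //; rewrite -[LHS]subr0 -h mE; ring.
  exact: dvdz_mulr.
rewrite dvdzE abszM abszX Euclid_dvdM // Euclid_dvdX //= andbT => n3.
have : (3 %| gcdn `|m| `|n|)%N by rewrite dvdn_gcd mE abszM dvdn_mull // n3.
by rewrite (eqP cop).
Qed.

(** The first two columns give [v = (a, l a, l^2 a)]; the last says that the cubic at [l], times
    [a], is 0. *)
Lemma cubic_companion_no_eigenvector (v : 'rV[rat]_3) l :
  v *m cubic_companion rat = l *: v -> v = 0.
Proof.
move=> /rowP vA.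
have := vA 0; have := vA (@lift 3 0 0).
have := vA (@lift 3 0 (@lift 2 0 0)).
rewrite !mxE !big_ord_recl !big_ord0 !mxE /=.
set a := v 0 ord0; set b := v 0 (@lift 3 _ ord0); set c := v 0 (@lift 3 _ _).
move=> e2 e1 e0.
have be : b = l * a by rewrite -e0; ring.
have ce : c = l * b by rewrite -e1; ring.
have a0 : a = 0.
  apply: (mulfI (cubic_no_rat_root l)); rewrite mulr0.
  have -> : (l ^+ 3 + 3 * l + 6) * a = l * c - (-6 * a - 3 * b).
    by rewrite ce be; ring.
  by rewrite -e2; ring.
by apply/rowP => k; rewrite mxE; case: (unliftP 0 k) => [k1|] ->; first
  case: (unliftP 0 k1) => [k2|] ->; rewrite ?(ord1 k2) -/a -/b -/c
    ?ce ?be ?a0 ?mulr0.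
Qed.

(** Certificate of non-invertibility: an inverse of [A] would make [w] divisible by 2, although its
    first entry is 1. *)
Lemma even_row_comb_nunit n (A : 'M[Zloc2]_n.+1) (w w' : 'rV[Zloc2]_n.+1) :
  w *m A = 2 *: w' -> w 0 0 = 1 -> ~ is_unit A.
Proof.
move=> wA w1 [B [AB _]].
have /rowP/(_ 0) : w = 2 *: (w' *m B).
  by rewrite scalemxAl -wA -mulmxA [A *m B]AB mulmx1.
by rewrite w1 mxE => /esym/eqP; apply/negP/Zloc2_two_nunit.
Qed.

Lemma not_strongly_clean_mx3 : ~ strongly_clean 'M[Zloc2]_3.
Proof.
move=> /(_ (cubic_companion Zloc2))[e [u [AE ee uu eu]]].
pose q : {rmorphism Zloc2 -> rat} := val.
pose E := map_mx q e.
have EE : E *m E = E by rewrite -map_mxM [e *m e]ee.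
have qA : map_mx q (cubic_companion Zloc2) = cubic_companion rat.
  apply/matrixP => i j; rewrite !mxE.
  by case: i j => [[|[|[|?]]] ?] [[|[|[|?]]] ?].
have cEA : comm_mx E (cubic_companion rat).
  by rewrite /comm_mx -qA -!map_mxM AE mulmxDl mulmxDr [e *m u]eu.
have Einj (e' : 'M[Zloc2]_3) : map_mx q e' = E -> e = e'.
  move=> /matrixP EE'; apply/matrixP => i j; apply: val_inj.
  by have := EE' i j; rewrite !mxE => /esym.
have [E0|E1] :=
  idempotent_commuting_no_eigenvector cubic_companion_no_eigenvector EE cEA.
- have e0 : e = 0 by apply: Einj; rewrite map_mx0 E0.
  rewrite e0 add0r in AE; move: uu; rewrite -AE.
  (* The first row of [C] is [(0, 0, -6)], and 6 is the cubic at 0. *)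
  apply: (@even_row_comb_nunit _ _ (\row_j nth 0 [:: 1; 0; 0] j)
                                  (\row_j nth 0 [:: 0; 0; -3] j)).
    apply/rowP; case=> [[|[|[|?]]] ?] //;
      by rewrite !mxE !big_ord_recl !big_ord0 !mxE /=; ring.
  by rewrite mxE.
have e1 : e = 1 by apply: Einj; rewrite map_mx1 E1.
have uE : u = cubic_companion Zloc2 - 1 by rewrite AE e1 addrC addKr.
move: uu; rewrite uE.
(* The rows of [C - 1] add up to [(0, 0, -10)], and 10 is the cubic at 1. *)
apply: (@even_row_comb_nunit _ _ (const_mx 1) (\row_j nth 0 [:: 0; 0; -5] j)).
  apply/rowP; case=> [[|[|[|?]]] ?] //;
    by rewrite !mxE !big_ord_recl !big_ord0 !mxE /=; ring.
by rewrite mxE.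
Qed.

Theorem mainTheorem3 :
  [/\ ~ strongly_clean 'M[Zloc2]_3 /\ ~ quasipolar 'M[Zloc2]_3,
      quasipolar (patternRing array1),
      quasipolar (patternRing array2),
      quasipolar (patternRing array3) &
      quasipolar (patternRing array4)].
Proof.
split; first split.
- exact: not_strongly_clean_mx3.
- by move/quasipolar_strongly_clean/not_strongly_clean_mx3.
(* Antisymmetry of each pattern remains, a check over pairs of indices. *)
all: apply: quasipolar_patternRing => i j /andP[].
all: by case: i j => [[|[|[|?]]] ?] [[|[|[|?]]] ?] //= _ _; apply: val_inj.
Qed.
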